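(* Let $z_i\in\mathbb R^{n_i}$, neighbor data $\zeta_{\mathcal N_i}$ and a number $b\ge0$ be given, and consider the one-step terminal feasibility condition: find $v_i\in\mathcal U_i$ with $$W_i\bigl(g_i(z_i,\zeta_{\mathcal N_i},v_i)\bigr)\le b.\qquad(\ast)$$ Suppose $g_i(z_i,\zeta_{\mathcal N_i},v_i)=a_i(z_i,\zeta_{\mathcal N_i})+G_iv_i$. (i) If $W_i(y)=y^\top P_iy$ with $P_i\succ0$ and $\mathcal U_i=\{v_i:H_iv_i\le h_i\}$, then $(\ast)$ is equivalent to $$H_iv_i\le h_i,\qquad\|P_i^{1/2}(a_i(z_i,\zeta_{\mathcal N_i})+G_iv_i)\|_2\le\sqrt b,$$ which is a second-order cone feasibility problem in $v_i$. (ii) If $v_i$ is scalar, $\mathcal U_i=[\underline u_i,\overline u_i]$ and $W_i(y)=p_i(c_i^\top y)^2$ with $p_i>0$, set $\alpha_i:=c_i^\top a_i(z_i,\zeta_{\mathcal N_i})$, $\beta_i:=c_i^\top G_i$, $h_i:=\sqrt{b/p_i}$. If $\beta_i\ne0$, $(\ast)$ is feasible if and only if $$[\underline u_i,\overline u_i]\cap\left[\min\left\{\frac{-h_i-\alpha_i}{\beta_i},\frac{h_i-\alpha_i}{\beta_i}\right\},\max\left\{\frac{-h_i-\alpha_i}{\beta_i},\frac{h_i-\alpha_i}{\beta_i}\right\}\right]\ne\varnothing.$$ If $\beta_i=0$, $(\ast)$ is feasible if and only if $|\alpha_i|\le h_i$.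
   Context: In the source, subsystem $i$ of a network has dynamics $x_i^+=g_i(x_i,x_{\mathcal N_i},u_i)$ with neighbor states $x_{\mathcal N_i}=(x_j)_{j\in\mathcal N_i}$ and input set $\mathcal U_i$; $z_i=\tilde x_i^{\mathrm{nom}}(M-1|t+1)$ is the last state of the shifted candidate prediction, $\zeta_{\mathcal N_i}=\bar x_{\mathcal N_i}(M-1|t+1)$ the received neighbor prediction, and $b=\max_j\gamma_{ij}(W_j(x_j(t+1)))\ge0$, with gains $\gamma_{ij}:\mathbb R_{\ge0}\to\mathbb R_{\ge0}$ and functions $W_j\ge0$. For this statement they are fixed data. In (ii), $\underline u_i\le\overline u_i$. $P_i^{1/2}$ is the principal square root. *)

(* Defs.v *)
From HB Require Import structures.
From mathcomp Require Import all_boot all_order all_algebra.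
From mathcomp Require Import sesquilinear.
From mathcomp Require Import boolp classical_sets set_interval reals.

Set Implicit Arguments.
Unset Strict Implicit.
Unset Printing Implicit Defensive.

Import Order.TTheory GRing.Theory Num.Theory.
Local Open Scope ring_scope.
Local Open Scope classical_set_scope.

(* x_N = (x_j)_{j \in N}, where subsystem j has state space R^(n j). *)
Definition nbr_state (R : realType) (I : finType) (n : I -> nat)
    (N : {set I}) : Type :=
  forall j : {j : I | j \in N}, 'cV[R]_(n (sval j)).

(* The library's norm `|v| on matrices is the max norm, not the 2-norm. *)
Definition norm2 (R : realType) (n : nat) (v : 'cV[R]_n) : R :=
  Num.sqrt (\sum_(k < n) v k 0 ^+ 2).

Definition lecv (R : realType) (k : nat) (x y : 'cV[R]_k) : Prop :=
  forall j : 'I_k, x j 0 <= y j 0.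

Definition quadform (R : realType) (n : nat) (P : 'M[R]_n) (y : 'cV[R]_n) : R :=
  (y^T *m P *m y) 0 0.

Definition posdefmx (R : realType) (n : nat) (P : 'M[R]_n) : Prop :=
  P \is symmetricmx /\ forall y : 'cV[R]_n, y != 0 -> 0 < quadform P y.

Definition possemidefmx (R : realType) (n : nat) (P : 'M[R]_n) : Prop :=
  P \is symmetricmx /\ forall y : 'cV[R]_n, 0 <= quadform P y.

(* The principal square root P^(1/2): the symmetric positive semidefinite S
   with S^2 = P. It is unique whenever it exists, which is the case exactly
   when P is symmetric positive semidefinite; the value 0 returned otherwise
   is junk. *)
Definition sqrtmx (R : realType) (n : nat) (P : 'M[R]_n) : 'M[R]_n :=
  xget 0 [set S : 'M[R]_n | possemidefmx S /\ S *m S = P].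

(* "v solves: find v in U with W (g z zeta v) <= b". The input space V is a
   parameter so that inputs may be vectors or scalars. *)
Definition terminal_solution (R : realType) (X Y V : Type) (W : X -> R)
    (g : X -> Y -> V -> X) (U : set V) (z : X) (zeta : Y) (b : R) (v : V) :
    Prop :=
  U v /\ W (g z zeta v) <= b.

Definition terminal_feasible (R : realType) (X Y V : Type) (W : X -> R)
    (g : X -> Y -> V -> X) (U : set V) (z : X) (zeta : Y) (b : R) : Prop :=
  exists v : V, terminal_solution W g U z zeta b v.

(* The second-order cone constraint || A v + f ||_2 <= c v + d on v in R^m. *)
Record soc_constraint (R : realType) (m : nat) := SocConstraint {
  soc_dim : nat;
  soc_A : 'M[R]_(soc_dim, m);
  soc_f : 'cV[R]_soc_dim;
  soc_c : 'rV[R]_m;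
  soc_d : R }.

Definition soc_holds (R : realType) (m : nat) (C : soc_constraint R m)
    (v : 'cV[R]_m) : bool :=
  norm2 (soc_A C *m v + soc_f C) <= (soc_c C *m v) 0 0 + soc_d C.

(* A second-order cone feasibility problem: find v satisfying a finite list of
   second-order cone constraints. *)
Definition soc_problem (R : realType) (m : nat) : Type :=
  seq (soc_constraint R m).

Definition soc_solution (R : realType) (m : nat) (pb : soc_problem R m)
    (v : 'cV[R]_m) : bool :=
  all (fun C => soc_holds C v) pb.

(* A linear inequality r v <= d is the cone constraint 0 <= - r v + d, whose
   left-hand side is the norm of a vector with no entries. *)
Definition linear_soc (R : realType) (m : nat) (r : 'rV[R]_m) (d : R) :
    soc_constraint R m :=
  SocConstraint (0 : 'M[R]_(0, m)) 0 (- r) d.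

Definition polyhedron_soc (R : realType) (m k : nat) (H : 'M[R]_(k, m))
    (h : 'cV[R]_k) : soc_problem R m :=
  [seq linear_soc (row j H) (h j 0) | j <- enum 'I_k].

(* Main.v *)
(* The one nontrivial point is that P^(1/2) exists. A real symmetric matrix is
   diagonalizable over R: the spectral theorem applies over R[i], the eigenvalues
   are real, and real matrices similar over R[i] are similar over R. Interpolating
   the fourth root on the spectrum gives a polynomial T in P with T^4 = P. Since T
   is symmetric, S = T^2 satisfies y^T S y = |T y|^2 >= 0 and S^2 = P. *)

Require Import Defs.
From HB Require Import structures.
From mathcomp Require Import all_boot all_order all_algebra.
From mathcomp Require Import sesquilinear spectral.
From mathcomp Require Import boolp classical_sets set_interval reals.
From mathcomp Require Import complex.

Set Implicit Arguments.
Unset Strict Implicit.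
Unset Printing Implicit Defensive.

Import Order.TTheory GRing.Theory Num.Theory.
Local Open Scope ring_scope.
Local Open Scope classical_set_scope.

Lemma symmetricmxP (F : fieldType) n {P : 'M[F]_n} :
  reflect (P^T = P) (P \is symmetricmx).
Proof.
apply: (iffP (is_hermitianmxP _ _ _)) => [|PT]; last first.
  by rewrite expr0 scale1r map_mx_id ?PT.
by rewrite expr0 scale1r map_mx_id.
Qed.

Lemma symmetricmx_diagonalizable (R : rcfType) n (P : 'M[R]_n) :
  P \is symmetricmx -> diagonalizable P.
Proof.
move=> /symmetricmxP Psym; pose A := map_mx (real_complex R) P.
have realC m p (B : 'M[R]_(m, p)) :
    map_mx (real_complex R) B \is a mxOver Num.real.
  by apply/mxOverP => i j; rewrite mxE; apply/complex_realP; exists (B i j).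
have realCK m p (B : 'M[R[i]]_(m, p)) : B \is a mxOver Num.real ->
    map_mx (real_complex R) (map_mx (@complex.Re R) B) = B.
  by move=> /mxOverP Breal; apply/matrixP => i j; rewrite !mxE RRe_real.
have Asym : A \is symmetricmx by apply/symmetricmxP; rewrite map_trmx Psym.
(* Conjugation fixes real entries, so a real symmetric matrix is Hermitian over [R[i]], hence
   normal. *)
have Aherm : A \is hermsymmx by apply: realsym_hermsym Asym _; exact: realC.
have /orthomx_spectralP AE : A \is normalmx by exact: hermitian_normalmx.
have Vunit := spectral_unit A.
pose d := map_mx (@complex.Re R) (spectral_diag A).
have dE : map_mx (real_complex R) d = spectral_diag A.
  by rewrite realCK ?hermitian_spectral_diag_real.
(* The spectral theorem gives a unitary conjugation, possibly non-real. As both [A] and its diagonal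
   form are real, it can be replaced by a real [Q], whose real part descends to [R]. *)
have [|||Q /andP[/= Qreal Qunit] /(simmxP Qunit) QA] :=
    @real_similar _ _ A (diag_mx (spectral_diag A)).
- exists (spectralmx A) => //; apply/simmxP => //.
  by rewrite {2}AE !mulmxA mulmxV // mul1mx.
- exact: realC.
- by rewrite -dE -map_diag_mx; exact: realC.
exists (map_mx (@complex.Re R) Q).
  by rewrite -(map_unitmx (real_complex R)) realCK.
apply/diagonalizable_forPex; exists d; apply/simmxP.
  by rewrite -(map_unitmx (real_complex R)) realCK.
apply: (map_mx_inj (f := real_complex R)).
by rewrite !map_mxM /= realCK // map_diag_mx dE.
Qed.

(** Newton's step: the nodal polynomial [w] vanishes on the old nodes and not at the new one, so a
    multiple of it corrects the value at [x] alone. Repeated nodes are skipped, which allows for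
    multiple eigenvalues. *)
Lemma poly_interpolation (F : fieldType) (f : F -> F) (s : seq F) :
  exists p : {poly F}, {in s, forall x, p.[x] = f x}.
Proof.
elim: s => [|x s [p pE]]; first by exists 0.
have [xs|xs] := boolP (x \in s).
  by exists p => y /[!inE] /predU1P[->|]; exact: pE.
pose w := \prod_(y <- s) ('X - y%:P).
have wx : w.[x] != 0 by rewrite -rootE root_prod_XsubC.
exists (p + ((f x - p.[x]) / w.[x]) *: w) => y /[!inE] /predU1P[->|ys].
  by rewrite !hornerE mulfVK // addrC subrK.
have /rootP wy : root w y by rewrite root_prod_XsubC.
by rewrite !hornerE wy mulr0 addr0 pE.
Qed.

Lemma trmx_horner_mx (R : comNzRingType) n (A : 'M[R]_n.+1) (p : {poly R}) :
  (horner_mx A p)^T = horner_mx A^T p.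
Proof.
elim/poly_ind: p => [|p c IH]; first by rewrite !rmorph0 trmx0.
rewrite !rmorphD !rmorphM /= !horner_mx_X !horner_mx_C linearD /= tr_scalar_mx.
(* Transposing reversed the product; a matrix commutes with its own polynomials. *)
by rewrite trmx_mul IH; congr (_ + _); apply/esym/comm_horner_mx.
Qed.

Lemma norm2_ge0 (R : realType) n (y : 'cV[R]_n) : 0 <= norm2 y.
Proof. exact: sqrtr_ge0. Qed.

Lemma sqr_norm2 (R : realType) n (y : 'cV[R]_n) : norm2 y ^+ 2 = (y^T *m y) 0 0.
Proof.
rewrite sqr_sqrtr ?sumr_ge0 // => [|k _]; last exact: sqr_ge0.
by rewrite mxE; apply: eq_bigr => k _; rewrite mxE -expr2.
Qed.

(** This serves twice: it makes the square of a symmetric matrix positive semidefinite, and it turns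
    [quadform P] into the norm in the cone constraint. *)
Lemma quadform_mul_sym (R : realType) n (S : 'M[R]_n) (y : 'cV[R]_n) :
  S \is symmetricmx -> quadform (S *m S) y = norm2 (S *m y) ^+ 2.
Proof.
by move=> /symmetricmxP ST; rewrite sqr_norm2 trmx_mul ST /quadform !mulmxA.
Qed.

(** For a row eigenvector u, u P u^T = l |u|^2, and |u|^2 > 0. *)
Lemma eigenvalue_possemidef_ge0 (R : realType) n (P : 'M[R]_n) (l : R) :
  possemidefmx P -> eigenvalue P l -> 0 <= l.
Proof.
move=> [_ Ppos] /eigenvalueP[u uP u0].
have := Ppos u^T; rewrite /quadform trmxK uP -scalemxAl mxE.
have -> : (u *m u^T) 0 0 = norm2 u^T ^+ 2 by rewrite sqr_norm2 trmxK.
rewrite pmulr_lge0 // lt_def sqr_ge0 andbT sqr_norm2 trmxK.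
apply: contra u0; rewrite mxE => /eqP u2; apply/eqP/rowP => k; rewrite mxE.
have sq0 j : true -> 0 <= u 0 j * u^T j 0 by rewrite mxE -expr2 sqr_ge0.
move: u2 => /(psumr_eq0P sq0)/(_ k isT)/eqP.
by rewrite mxE mulf_eq0 orbb => /eqP.
Qed.

Lemma possemidefmx_sqrt_exists (R : realType) n (P : 'M[R]_n) :
  possemidefmx P -> exists S : 'M[R]_n, possemidefmx S /\ S *m S = P.
Proof.
(* [horner_mx] requires a positive dimension; in dimension 0 all matrices coincide. *)
case: n P => [|n] P Ppos.
  by exists P; split=> //; apply/matrixP => -[].
have [Psym _] := Ppos.
have [Q Qunit /diagonalizable_forPex[d /(simmxP Qunit) QP]] :=
  symmetricmx_diagonalizable Psym.
have PE : P = invmx Q *m diag_mx d *m Q by rewrite -mulmxA -QP mulKmx.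
have d_ge0 k : 0 <= d 0 k.
  apply: eigenvalue_possemidef_ge0 Ppos _; apply/eigenvalueP.
  exists (row k Q).
    by rewrite -row_mul QP mul_diag_mx; apply/rowP => j; rewrite !mxE.
  (* The row is nonzero: multiplied by [invmx Q] it becomes a row of the identity, with entry 1 at
     [k]. *)
  apply/eqP => /(congr1 (mulmx^~ (invmx Q))); rewrite -row_mul mulmxV // mul0mx.
  by move=> /rowP/(_ k)/eqP; rewrite !mxE eqxx oner_eq0.
have [q qE] := poly_interpolation (Num.sqrt \o Num.sqrt) [seq d 0 k | k : 'I_n.+1].
pose T := horner_mx P q.
have Tsym : T \is symmetricmx.
  by apply/symmetricmxP; rewrite trmx_horner_mx (symmetricmxP Psym).
exists (T *m T); split.
  split; first by apply/symmetricmxP; rewrite trmx_mul (symmetricmxP Tsym).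
  by move=> y; rewrite quadform_mul_sym // sqr_ge0.
have -> : T *m T *m (T *m T) = horner_mx P (q ^+ 2 ^+ 2).
  by rewrite !rmorphXn /= !expr2.
(* Polynomials pass through the conjugation by [Q] and act entrywise on [d], which leaves q(d_k)^4 =
   d_k; this holds because d_k >= 0. *)
rewrite PE horner_mx_uconjC // horner_mx_diag; congr (_ *m diag_mx _ *m _).
apply/rowP => k; rewrite !mxE !hornerE qE /=; last by apply: map_f; rewrite mem_enum.
by rewrite !sqr_sqrtr ?sqrtr_ge0.
Qed.

(** Existence excludes the default value of [xget], so the chosen matrix has the defining
    properties. *)
Lemma sqrtmxP (R : realType) n (P : 'M[R]_n) : possemidefmx P ->
  possemidefmx (sqrtmx P) /\ sqrtmx P *m sqrtmx P = P.
Proof.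
move=> /possemidefmx_sqrt_exists.
exact: (@xgetPex _ 0 [set S : 'M[R]_n | possemidefmx S /\ S *m S = P]).
Qed.

Lemma posdefmx_possemidef (R : realType) n (P : 'M[R]_n) :
  posdefmx P -> possemidefmx P.
Proof.
move=> [Psym Ppos]; split=> // y; have [->|/Ppos/ltW//] := eqVneq y 0.
by rewrite /quadform mulmx0 mxE.
Qed.

Lemma linear_socE (R : realType) m (r : 'rV[R]_m) (e : R) (v : 'cV[R]_m) :
  soc_holds (linear_soc r e) v = ((r *m v) 0 0 <= e).
Proof.
by rewrite /soc_holds /= /norm2 big_ord0 sqrtr0 mulNmx mxE addrC subr_ge0.
Qed.

Lemma norm2_socE (R : realType) m k (A : 'M[R]_(k, m)) (f : 'cV[R]_k) (e : R)
    (v : 'cV[R]_m) :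
  soc_holds (SocConstraint A f 0 e) v = (norm2 (A *m v + f) <= e).
Proof. by rewrite /soc_holds /= mul0mx [(0 : 'M_1) _ _]mxE add0r. Qed.

Lemma polyhedron_socP (R : realType) m k (H : 'M[R]_(k, m)) (h : 'cV[R]_k)
    (v : 'cV[R]_m) :
  soc_solution (polyhedron_soc H h) v <-> lecv (H *m v) h.
Proof.
rewrite /soc_solution all_map; split=> [/allP Hv j|Hv].
  have := Hv j; rewrite mem_enum /= linear_socE -row_mul mxE; exact.
by apply/allP => j _; rewrite /= linear_socE -row_mul mxE.
Qed.

Lemma pmulr_sqr_le (R : rcfType) (p b x : R) : 0 < p -> 0 <= b ->
  (p * x ^+ 2 <= b) = (`|x| <= Num.sqrt (b / p)).
Proof.
move=> p0 b0; rewrite -sqrtr_sqr ler_sqrt ?divr_ge0 ?(ltW p0) //.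
by rewrite ler_pdivlMr // mulrC.
Qed.

(** The condition reads - h - alpha <= v beta <= h - alpha. Dividing by [beta] keeps or swaps the
    endpoints according to its sign, which [Num.min] and [Num.max] absorb. *)
Lemma normr_affine_le_itv (R : realFieldType) (alpha beta h v : R) :
    0 <= h -> beta != 0 ->
  (`|alpha + v * beta| <= h) =
  (Num.min ((- h - alpha) / beta) ((h - alpha) / beta) <= v <=
   Num.max ((- h - alpha) / beta) ((h - alpha) / beta)).
Proof.
move=> h0 beta0; have hN : - h - alpha <= h - alpha.
  by rewrite lerD2r (le_trans _ h0) // oppr_le0.
rewrite ler_norml -lerBlDl -[X in _ && X]lerBrDl.
have [beta_gt0|] := ltP 0 beta.
  rewrite min_l ?max_r ?ler_pM2r ?invr_gt0 //.
  by rewrite ler_pdivrMr // ler_pdivlMr.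
rewrite le_eqVlt (negPf beta0) /= => beta_lt0.
rewrite min_r ?max_l ?ler_nM2r ?invr_lt0 //.
by rewrite ler_ndivrMr // ler_ndivlMr // andbC.
Qed.

Theorem lemma2 (R : realType) (I : finType) (n : I -> nat) (i : I)
    (N : {set I})
    (W : 'cV[R]_(n i) -> R)
    (a : 'cV[R]_(n i) -> nbr_state R n N -> 'cV[R]_(n i))
    (z : 'cV[R]_(n i)) (zeta : nbr_state R n N) (b : R) (hb : 0 <= b) :
  (* (i) *)
  (forall (m k : nat)
      (g : 'cV[R]_(n i) -> nbr_state R n N -> 'cV[R]_m -> 'cV[R]_(n i))
      (G : 'M[R]_(n i, m)) (U : set 'cV[R]_m)
      (P : 'M[R]_(n i)) (H : 'M[R]_(k, m)) (h : 'cV[R]_k),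
    (forall v : 'cV[R]_m, g z zeta v = a z zeta + G *m v) ->
    posdefmx P ->
    (forall y : 'cV[R]_(n i), W y = quadform P y) ->
    U = [set v : 'cV[R]_m | lecv (H *m v) h] ->
    (forall v : 'cV[R]_m,
       terminal_solution W g U z zeta b v <->
       lecv (H *m v) h /\
       norm2 (sqrtmx P *m (a z zeta + G *m v)) <= Num.sqrt b) /\
    (forall v : 'cV[R]_m,
       lecv (H *m v) h /\
       norm2 (sqrtmx P *m (a z zeta + G *m v)) <= Num.sqrt b <->
       soc_solution
         (rcons (polyhedron_soc H h)
            (SocConstraint (sqrtmx P *m G) (sqrtmx P *m a z zeta)
               0 (Num.sqrt b))) v)) /\
  (* (ii) *)
  (forall (g : 'cV[R]_(n i) -> nbr_state R n N -> R -> 'cV[R]_(n i))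
      (G : 'cV[R]_(n i)) (U : set R) (ulo uhi p : R) (c : 'cV[R]_(n i)),
    (forall v : R, g z zeta v = a z zeta + v *: G) ->
    ulo <= uhi ->
    U = `[ulo, uhi] ->
    0 < p ->
    (forall y : 'cV[R]_(n i), W y = p * (c^T *m y) 0 0 ^+ 2) ->
    let alpha := (c^T *m a z zeta) 0 0 in
    let beta := (c^T *m G) 0 0 in
    let h := Num.sqrt (b / p) in
    (beta != 0 ->
       terminal_feasible W g U z zeta b <->
       `[ulo, uhi] `&`
       `[Num.min ((- h - alpha) / beta) ((h - alpha) / beta),
         Num.max ((- h - alpha) / beta) ((h - alpha) / beta)] !=set0) /\
    (beta = 0 ->
       terminal_feasible W g U z zeta b <-> `|alpha| <= h)).
Proof.
split.
  move=> m k g G U P H h gE Ppos WE UE.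
  have [[Ssym _] SS] := sqrtmxP (posdefmx_possemidef Ppos).
  split=> v.
    (* With P = S^2 the bound becomes |S y|^2 <= (sqrt b)^2, and squaring preserves the order of
       nonnegative numbers. *)
    rewrite /terminal_solution UE gE WE -[in quadform _ _]SS quadform_mul_sym //.
    by rewrite -{1}(sqr_sqrtr hb) ler_sqr // ?nnegrE ?norm2_ge0 ?sqrtr_ge0.
  rewrite /soc_solution all_rcons norm2_socE -mulmxA -mulmxDr (addrC (G *m v)).
  split=> [[/polyhedron_socP Hv ->]|/andP[-> Hv]]; first exact: Hv.
  by split=> //; exact/polyhedron_socP.
move=> g G U ulo uhi p c gE u_le UE p0 WE alpha beta h.
have h0 : 0 <= h by exact: sqrtr_ge0.
(* Since c^T (a + v G) = alpha + v beta, both cases of (ii) reduce to this scalar inequality. *)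
have solE v : (W (g z zeta v) <= b) = (`|alpha + v * beta| <= h).
  rewrite gE WE pmulr_sqr_le // mulmxDr -scalemxAr.
  by rewrite [X in `|X|]mxE [X in _ + X]mxE.
split=> [beta0|beta0].
  split=> -[v].
    rewrite /terminal_solution UE solE normr_affine_le_itv // => -[Uv vI].
    by exists v; split=> //=; rewrite in_itv.
  move=> [Uv /=]; rewrite in_itv /= -normr_affine_le_itv // -solE => vI.
  by exists v; split=> //; rewrite UE.
split=> [[v [_]]|ah]; first by rewrite solE beta0 mulr0 addr0.
(* For beta = 0 the inequality does not depend on [v], so any admissible input works; [ulo] is one
   because [ulo <= uhi]. *)
exists ulo; split; last by rewrite solE beta0 mulr0 addr0.
by rewrite UE /= in_itv /= lexx.
Qed.
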